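(* Let $R$ be either the field $\mathbb{F}_4$ or the ring $R_4\cong\mathbb{F}_2\times\mathbb{F}_2$, and let $C\subseteq R^n$ be a linear code over $R$. Then for all admissible $\ell,\ell'$ (for $R$) such that $\ell>\ell'$, $$\Theta_{\Lambda_\ell(C)}(q)=\Theta_{\Lambda_{\ell'}(C)}(q)+\mathcal{O}\left(q^{\frac{\ell'+1}{4}}\right).$$
   Context: Rings. $\mathbb{F}_4=\{0,1,\omega,1+\omega\}$ with $\omega^2+\omega+1=0$; $R_4=\mathbb{F}_2+\omega\mathbb{F}_2=\{0,1,\omega,1+\omega\}$ with $\omega^2+\omega=0$, so $R_4\cong\mathbb{F}_2\times\mathbb{F}_2$. A linear code $C$ of length $n$ over $R$ is an $R$-submodule of $R^n$. Admissible levels. An admissible level $\ell$ for $R$ is a positive square-free integer with $\ell\equiv 3 \bmod 8$ if $R=\mathbb{F}_4$, and with $\ell\equiv 7\bmod 8$ if $R=R_4$. Lattices. For admissible $\ell$ let $K=\mathbb{Q}(\sqrt{-\ell})$, with ring of integers $\mathcal{O}_K=\mathbb{Z}[\omega_\ell]$, $\omega_\ell=\frac{-1+\sqrt{-\ell}}{2}$. The quotient $\mathcal{O}_K/2\mathcal{O}_K$ has coset representatives $0,1,\omega_\ell,1+\omega_\ell$ and is identified with $R$ by $\omega_\ell\mapsto\omega$. Let $\rho_\ell:\mathcal{O}_K\to\mathcal{O}_K/2\mathcal{O}_K\cong R$ be the projection, applied componentwise to vectors, and set $\Lambda_\ell(C)=\{x\in\mathcal{O}_K^n:\rho_\ell(x)\in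 C\}$. Theta functions. $\Theta_{\Lambda_\ell(C)}(q)=\sum_{z\in\Lambda_\ell(C)}q^{z\cdot\bar z}$, where $z\cdot\bar z=\sum_{i=1}^n z_i\bar z_i$ is a nonnegative integer and $q=e^{\pi i\tau}$ with $\operatorname{Im}\tau>0$ (equivalently, regard it as a formal power series in $q$). $\mathcal{O}(q^{m})$ denotes a power series in $q$ all of whose terms have exponent at least $m$. *)

(* Defs.v *)
From HB Require Import structures.
From mathcomp Require Import all_boot all_order all_algebra all_field.
From mathcomp Require Import boolp classical_sets functions cardinality fsbigop.
From mathcomp Require Import ring lra zify.

Set Implicit Arguments.
Unset Strict Implicit.
Unset Printing Implicit Defensive.

Import Order.TTheory GRing.Theory Num.Theory.
Local Open Scope classical_set_scope.
Local Open Scope ring_scope.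

Inductive alphabet := F4 | R4.

Definition modulus (A : alphabet) : {poly 'F_2} :=
  match A with F4 => 'X^2 + 'X + 1 | R4 => 'X^2 + 'X end.

(* F_2[X] / (modulus); the class 'qX of 'X is the element omega of R. *)
Notation carrier A := {poly %/ modulus A}.

Notation omega A := ('qX : carrier A).

Definition linear_code (A : alphabet) (n : nat) (C : {pred 'rV[carrier A]_n}) : Prop :=
  submod_closed C.

Definition square_free (l : nat) : Prop :=
  forall d : nat, (d ^ 2 %| l)%N -> d = 1%N.

Definition admissible (A : alphabet) (l : nat) : Prop :=
  [/\ (0 < l)%N, square_free l &
      match A with F4 => l = 3 %[mod 8] | R4 => l = 7 %[mod 8] end].

Section Lattices.
Variable l : nat.

Definition sqrtN : algC := sqrtC (- l%:R).

(* The field Q(sqrt(-l)), embedded in the algebraic numbers. *)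
Definition K : set algC :=
  [set x : algC | exists a b : rat, x = ratr a + ratr b * sqrtN].

Definition OK : set algC := [set x : algC | K x /\ x \in Aint].

Definition omegal : algC := (-1 + sqrtN) / 2.

(* The coset representative 0, 1, omegal or 1 + omegal that corresponds to r. *)
Definition repr (A : alphabet) (r : carrier A) : algC :=
  let c (i : nat) : 'F_2 := r`_i in (c 0%N)%:R + (c 1%N)%:R * omegal.

(* Reduction modulo 2 OK. For x in OK such an r exists and is unique (see
   rho_omega), so the default value 0 plays no role in Lambda. *)
Definition rho (A : alphabet) (x : algC) : carrier A :=
  xget 0 [set r : carrier A | exists2 y, OK y & x - repr r = 2 * y].

Definition Lambda (A : alphabet) (n : nat) (C : {pred 'rV[carrier A]_n}) :
    set 'rV[algC]_n :=
  [set x : 'rV[algC]_n | (forall i, OK (x 0 i)) /\ map_mx (@rho A) x \in C].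

End Lattices.

Definition hnorm (n : nat) (z : 'rV[algC]_n) : algC :=
  \sum_i z 0 i * (z 0 i)^*.

(* A formal power series in q is the sequence of its coefficients. *)
Definition qseries := nat -> int.

(* The k-th coefficient collects the terms q ^ hnorm z with hnorm z = k. *)
Definition Theta (n : nat) (L : set 'rV[algC]_n) : qseries :=
  fun k => \sum_(z \in L) ((hnorm z == k%:R)%:R : int).

Definition bigOq (m : nat) : set qseries :=
  [set E | forall k, (k < m)%N -> E k = 0].

Lemma size_modulus A : size (modulus A) = 3.
Proof.
have szXX : size ('X^2 + 'X : {poly 'F_2}) = 3.
  by rewrite size_polyDl size_polyXn // size_polyX.
by case: A => //=; rewrite size_polyDl szXX // size_polyC.
Qed.

Lemma monic_modulus A : modulus A \is monic.
Proof.
have mXX : ('X^2 + 'X : {poly 'F_2}) \is monic.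
  by rewrite monicE lead_coefDl ?size_polyXn ?size_polyX // lead_coefXn.
have szXX : size ('X^2 + 'X : {poly 'F_2}) = 3.
  by rewrite size_polyDl size_polyXn // size_polyX.
case: A => //=; rewrite monicE lead_coefDl; first exact: mXX.
by rewrite szXX size_polyC.
Qed.

Lemma mk_modulus A : mk_monic (modulus A) = modulus A.
Proof. by rewrite /mk_monic size_modulus monic_modulus. Qed.

Lemma omegaE A : omega A = 'X :> {poly 'F_2}.
Proof. by rewrite qpolyXE ?size_modulus ?monic_modulus. Qed.

Lemma omega_root A :
  omega A ^+ 2 + omega A + (if A is F4 then 1 else 0) = 0.
Proof.
transitivity (in_qpoly (modulus A) (modulus A)); last first.
  by apply/val_inj; rewrite /= mk_modulus Pdiv.RingMonic.rmodpp ?monic_modulus.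
by case: A => /=; rewrite ?addr0 !rmorphD ?rmorphXn //= rmorph1.
Qed.

Lemma F4_irreducible : monic_irreducible_poly (modulus F4).
Proof.
split; last exact: monic_modulus.
apply: cubic_irreducible; first by rewrite size_modulus.
move=> x; rewrite /root /= !hornerE.
by case: x => [[|[|//]] //= i].
Qed.

Lemma size_carrier A (r : carrier A) : (size (r : {poly 'F_2}) <= 2)%N.
Proof. by apply: leq_trans (size_npoly r) _; rewrite mk_modulus size_modulus. Qed.

Lemma carrierP A (r r' : carrier A) : r`_0 = r'`_0 -> r`_1 = r'`_1 -> r = r'.
Proof.
move=> e0 e1; apply/val_inj/polyP => -[|[|i]] //=.
by rewrite !nth_default // (leq_trans (size_carrier _)).
Qed.

Lemma carrier_coef A (a b : 'F_2) (r := a%:A + b *: omega A) :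
  r`_0 = a /\ r`_1 = b.
Proof.
rewrite /r poly_of_qpolyD !poly_of_qpolyZ omegaE /= !coefE /=.
by rewrite !mulr1 !mulr0 addr0 add0r.
Qed.

(* The ring isomorphism from R4 to F_2 x F_2 that maps omega to (0, 1). *)
Definition R4_pair (r : carrier R4) : 'F_2 * 'F_2 :=
  let p : {poly 'F_2} := r in (p.[0], p.[1]).

Lemma R4_pair_zmod : zmod_morphism R4_pair.
Proof. by move=> x y; rewrite /R4_pair /= !hornerE. Qed.

Lemma R4_pair_monoid : monoid_morphism R4_pair.
Proof.
split=> [|x y]; first by rewrite /R4_pair /= !hornerE.
have ev (c : 'F_2) (p : {poly 'F_2}) : (modulus R4).[c] = 0 ->
    (Pdiv.CommonRing.rmodp p (mk_monic (modulus R4))).[c] = p.[c].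
  move=> c0; rewrite mk_modulus [in RHS](Pdiv.RingMonic.rdivp_eq (monic_modulus R4) p).
  by rewrite hornerD hornerM c0 mulr0 add0r.
rewrite /R4_pair poly_of_qpolyM !ev; first by rewrite !hornerM.
  rewrite /= !hornerE. by apply/eqP.
  rewrite /= !hornerE. by apply/eqP.
Qed.

HB.instance Definition _ := GRing.isZmodMorphism.Build _ _ R4_pair R4_pair_zmod.
HB.instance Definition _ := GRing.isMonoidMorphism.Build _ _ R4_pair R4_pair_monoid.

Lemma R4_pair_bij : bijective R4_pair.
Proof.
apply: inj_card_bij; last first.
  by rewrite card_prod card_Fp // card_monic_qpoly ?size_modulus ?monic_modulus // card_Fp.
apply: raddf_inj => x; rewrite /R4_pair /= => -[h0 h1].
have x0 : x`_0 = 0 by rewrite -horner_coef0.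
apply: (@carrierP R4); rewrite [RHS]coef0 //.
by move: h1; rewrite (horner_coef_wide _ (size_carrier x)) !big_ord_recl big_ord0 /= x0 !mul0r
  add0r addr0 expr1n mulr1.
Qed.

Section Integers.
Variable l : nat.
Local Notation s := (sqrtN l).
Local Notation w := (omegal l).

Lemma sqrs : s ^+ 2 = - l%:R. Proof. exact: sqrtCK. Qed.


Lemma conj_s : s^* = - s.
Proof.
have h : s ^+ 2 = ('i * sqrtC l%:R) ^+ 2.
  by rewrite sqrs exprMn sqrCi sqrtCK; ring.
have c : ('i * sqrtC (l%:R : algC))^* = - ('i * sqrtC l%:R).
  rewrite rmorphM /= conjCi (CrealP _) ?mulNr //.
  by rewrite ger0_real // sqrtC_ge0.
by move/eqP: h; rewrite eqf_sqr => /orP[] /eqP->; rewrite ?rmorphN /= c.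
Qed.

Lemma s_omega : s = 2 * w + 1.
Proof. by rewrite /omegal; field. Qed.

Lemma K_omega (a b : rat) : K l (ratr a + ratr b * w).
Proof.
exists (a - b / 2), (b / 2); rewrite s_omega rmorphB !fmorph_div /= ratr_nat.
by field.
Qed.

Hypothesis hl : (l %% 4 = 3)%N.

Lemma omega_sqr : w ^+ 2 = - w - ((l + 1) %/ 4)%:R.
Proof.
have -> : w ^+ 2 = (1 - 2 * s + s ^+ 2) / 4 by rewrite /omegal; field.
have -> : w = (-1 + s) / 2 by [].
have e : (l%:R : algC) = 4 * ((l + 1) %/ 4)%:R - 1.
  by rewrite -natrM mulnC divnK ?natrD ?addrK //; lia.
by rewrite sqrs e; field.
Qed.

Lemma omega_Aint : w \in Aint.
Proof.
pose p : {poly algC} := 'X^2 + 'X + (((l + 1) %/ 4)%:R)%:P.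
have sXX : size ('X^2 + 'X : {poly algC}) = 3.
  by rewrite size_polyDl size_polyXn // size_polyX.
have ltc : (size ((((l + 1) %/ 4)%:R)%:P : {poly algC}) < 3)%N.
  by rewrite (leq_ltn_trans (size_polyC_leq1 _)).
apply: (@root_monic_Aint p).
- by apply/rootP; rewrite !hornerE omega_sqr; ring.
- rewrite monicE lead_coefDl ?sXX // lead_coefDl ?size_polyXn ?size_polyX //.
  by rewrite lead_coefXn.
- apply/polyOverP => i; rewrite /p !coefE.
  by case: (i =P 0) => _; rewrite ?addr0 -!natrD natr_int.
Qed.

Lemma omega_OK (a b : int) : OK l (a%:~R + b%:~R * w).
Proof.
split; first by have := K_omega a%:~R b%:~R; rewrite !ratr_int.
by rewrite rpredD ?Aint_int // rpredM ?Aint_int ?omega_Aint.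
Qed.

Lemma omega_indep (a b c d : int) :
  a%:~R + b%:~R * w = c%:~R + d%:~R * w -> a = c /\ b = d.
Proof.
move=> e.
have l0 : (l%:R : algC) != 0 by rewrite pnatr_eq0; lia.
have s0 : s != 0 by rewrite /sqrtN sqrtC_eq0 oppr_eq0.
have ec : a%:~R + b%:~R * w^* = c%:~R + d%:~R * w^*.
  by move/(congr1 (fun x => x^*)): e; rewrite !rmorphD !rmorphM /= !rmorph_int.
have cw : w^* = - w - 1.
  rewrite /omegal fmorph_div rmorphD rmorphN /= conj_s rmorph1 rmorph_nat.
  by field.
have bd : b%:~R = d%:~R :> algC.
  apply: (mulIf s0); rewrite s_omega.
  rewrite cw in ec.
  have -> : b%:~R * (2 * w + 1) =
    (a%:~R + b%:~R * w) - (a%:~R + b%:~R * (- w - 1)) by ring.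
  by rewrite e ec; ring.
by move: e; rewrite bd => /addIr /eqP; rewrite eqr_int => /eqP ->; split=> //;
  apply/eqP; rewrite -(@eqr_int algC) bd.
Qed.

Hypothesis sf : square_free l.

Lemma OK_omega (x : algC) :
  OK l x <-> exists a b : int, x = a%:~R + b%:~R * w.
Proof.
split=> [[[a [b ->]] xA]|[a [b ->]]]; last exact: omega_OK.
have cA : ratr a - ratr b * s \in Aint.
  have cr (q : rat) : (ratr q : algC)^* = ratr q by apply: conj_Crat; exact: Crat_rat.
  have ch (y z : algC) : y^* = y -> z^* = z -> y - z * s = (y + z * s)^*.
    by move=> ey ez; rewrite rmorphD rmorphM /= ey ez conj_s mulrN.
  by rewrite (ch _ _ (cr a) (cr b)) Aint_aut.
have : ratr (2 * a) \in (Num.int : {pred algC}).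
  apply: Cint_rat_Aint; first exact: Crat_rat.
  have -> : ratr (2 * a) = (ratr a + ratr b * s) + (ratr a - ratr b * s).
    by rewrite rmorphM /= ratr_nat; ring.
  exact: rpredD.
have : ratr (a ^+ 2 + l%:R * b ^+ 2) \in (Num.int : {pred algC}).
  apply: Cint_rat_Aint; first exact: Crat_rat.
  have -> : ratr (a ^+ 2 + l%:R * b ^+ 2) =
      (ratr a + ratr b * s) * (ratr a - ratr b * s).
    rewrite rmorphD rmorphM !rmorphXn /= ratr_nat.
    have -> : l%:R = - s ^+ 2 by rewrite sqrs opprK.
    by ring.
  exact: rpredM.
move=> /intrP[N]; rewrite -(ratr_int _ N) => /fmorph_inj Ne.
move=> /intrP[m]; rewrite -(ratr_int _ m) => /fmorph_inj me.
pose c := 2 * b.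
have ce : l%:R * c ^+ 2 = (4 * N - m ^+ 2)%:~R.
  by rewrite rmorphB rmorphM /= rmorphXn /= -me -Ne /c; ring.
have dc : denq c = 1.
  have d0 : (denq c)%:~R != 0 :> rat by rewrite intr_eq0 denq_neq0.
  have e : (l%:Z * numq c ^+ 2 = (4 * N - m ^+ 2) * denq c ^+ 2).
    apply: (@intr_inj rat); rewrite [LHS]intrM [RHS]intrM -ce !rmorphXn /=.
    have nE : (numq c)%:~R = c * (denq c)%:~R :> rat by rewrite -numqE.
    by rewrite nE; ring.
  have /dvdnP : (`|denq c| ^ 2 %| l * `|numq c| ^ 2)%N.
    have : (denq c ^+ 2 %| l%:Z * numq c ^+ 2)%Z by rewrite e dvdz_mull.
    by rewrite dvdzE abszM !abszX.
  move=> /dvdnP; rewrite Gauss_dvdl; last first.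
    by rewrite coprimeXl // coprimeXr // coprime_sym coprime_num_den.
  by move/sf; have := denq_gt0 c; lia.
have ci : c = (numq c)%:~R by rewrite -[LHS]divq_num_den dc divr1.
have : l%:Z * numq c ^+ 2 = 4 * N - m ^+ 2.
  by apply/eqP; rewrite -(@eqr_int rat) rmorphM rmorphXn /= -ci ce.
set u := numq c => eN.
have [k mk] : exists k, m + u = 2 * k.
  exists (((m + u) %/ 2)%Z).
  have le : l%:Z = 4 * (l %/ 4)%N%:Z + 3 by lia.
  have : ((m + u) ^+ 2 = 2 * (2*N - (2 * (l %/ 4)%N%:Z + 1) * u^+2 + m * u)).
    by move: eN; rewrite le => eN; nia.
  nia.
exists k, u.
have be : ratr b = u%:~R / 2 :> algC.
  have -> : b = u%:~R / 2 by rewrite -ci /c; field.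
  by rewrite fmorph_div /= ratr_int ratr_nat.
have ae : ratr a = k%:~R - u%:~R / 2 :> algC.
  have -> : a = k%:~R - u%:~R / 2.
    have -> : k%:~R = (m + u)%:~R / 2 :> rat by rewrite mk rmorphM /=; field.
    by rewrite rmorphD /= -me; field.
  by rewrite rmorphB fmorph_div /= !ratr_int ratr_nat.
by rewrite be ae s_omega; field.
Qed.
End Integers.

Lemma admissible_mod4 A l : admissible A l -> (l %% 4 = 3)%N.
Proof. by case: A => -[_ _] /= h; lia. Qed.

Lemma F2_parity (a : int) : exists k : int, a = (a%:~R : 'F_2)%:Z + 2 * k.
Proof.
exists (a %/ 2)%Z; rewrite {1}(divz_eq a 2) addrC [X in _ + X]mulrC; congr (_ + _).
have -> : (a%:~R : 'F_2) = ((a %% 2)%Z)%:~R.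
  rewrite {1}(divz_eq a 2) rmorphD rmorphM /=.
  by rewrite (_ : 2%:~R = 0 :> 'F_2) ?mulr0 ?add0r //; apply/val_inj.
have : ((a %% 2)%Z == 0) || ((a %% 2)%Z == 1) by lia.
by case/orP => /eqP ->.
Qed.

Lemma natF2K (x : 'F_2) : (x : nat)%:R = x :> 'F_2.
Proof. by case: x => [[|[|//]]] i; apply/val_inj. Qed.

Section Rho.
Variables (A : alphabet) (l : nat).
Hypothesis hl : (l %% 4 = 3)%N.
Hypothesis sf : square_free l.

Lemma rho_omega (a b : int) :
  rho l A (a%:~R + b%:~R * omegal l) = a%:~R + b%:~R * omega A.
Proof.
set r := (X in _ = X).
have rE : r = (a%:~R : 'F_2)%:A + (b%:~R : 'F_2) *: omega A.
  by rewrite /r !scaler_int mulrzl.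
have [r0 r1] := carrier_coef A a%:~R b%:~R; rewrite -rE in r0 r1.
apply: xget_unique => [|r' [y /(OK_omega hl sf)[c [d ->]] e]] /=.
  have [c ce] := F2_parity a; have [d de] := F2_parity b.
  exists (c%:~R + d%:~R * omegal l); first exact: omega_OK.
  rewrite /repr r0 r1 {1}ce {1}de !rmorphD !rmorphM /= -!pmulrn; ring.
have [ea eb] : a = ((r'`_0)%R : 'F_2)%:Z + 2 * c /\ b = ((r'`_1)%R : 'F_2)%:Z + 2 * d.
  apply: (@omega_indep l hl); move/eqP: e; rewrite subr_eq /repr => /eqP ->.
  by rewrite !rmorphD !rmorphM /= -!pmulrn; ring.
have t0 : 2 = 0 :> 'F_2 by apply/val_inj.
apply: carrierP; rewrite ?r0 ?r1 ?ea ?eb rmorphD rmorphM /=.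
  by rewrite -!pmulrn natF2K t0 mul0r addr0.
by rewrite -!pmulrn natF2K t0 mul0r addr0.
Qed.
End Rho.

Section Finite.
Variable l : nat.
Hypothesis hl : (l %% 4 = 3)%N.
Hypothesis sf : square_free l.

Lemma normE (a b : int) (z := a%:~R + b%:~R * omegal l) :
  z * z^* = (a ^+ 2 - a * b + b ^+ 2 * ((l + 1) %/ 4)%N%:Z)%:~R.
Proof.
have cw : (omegal l)^* = - omegal l - 1.
  rewrite /omegal fmorph_div rmorphD rmorphN /= conj_s rmorph1 rmorph_nat.
  by field.
rewrite /z rmorphD rmorphM /= !rmorph_int cw.
have w2 := omega_sqr hl.
transitivity (a%:~R ^+ 2 - a%:~R * b%:~R
   - b%:~R ^+ 2 * (omegal l ^+ 2 + omegal l)); first by ring.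
by rewrite w2 pmulrn; ring.
Qed.

Lemma form_ge (a b : int) (q := a ^+ 2 - a * b + b ^+ 2 * ((l + 1) %/ 4)%N%:Z) :
  3 * a ^+ 2 <= 4 * q /\ 3 * b ^+ 2 <= 4 * q.
Proof.
have m1 : 1 <= ((l + 1) %/ 4)%N%:Z by lia.
have : 0 <= b ^+ 2 * (((l + 1) %/ 4)%N%:Z - 1).
  by rewrite mulr_ge0 ?sqr_ge0 ?subr_ge0.
have sa := sqr_ge0 (2 * a - b); have sb := sqr_ge0 (2 * b - a).
by rewrite /q; move: ((l + 1) %/ 4)%N%:Z sa sb {m1 q} => m; split; lia.
Qed.

Lemma sqr_bound (a : int) (k : nat) : 3 * a ^+ 2 <= 4 * k%:Z -> (`|a| <= 4 * k)%N.
Proof.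
move=> h; have : `|a| <= a ^+ 2 by have [|] := leP 0 a => a0; [rewrite ger0_norm|rewrite ltr0_norm] => //; nia.
by lia.
Qed.

Lemma hnorm_nat n (z : 'rV[algC]_n) : (forall i, OK l (z 0 i)) ->
  hnorm z \in Num.nat.
Proof.
move=> zO; rewrite /hnorm rpred_sum // => i _.
have [a [b ->]] := (OK_omega hl sf _).1 (zO i).
rewrite normE natrEint intr_int /= ler0z.
have [h _] := form_ge a b; have := sqr_ge0 a; lia.
Qed.

(* The sums defining the coefficients of Theta (Lambda l C) are finite. *)
Lemma finite_hnorm n (k : nat) :
  finite_set [set z : 'rV[algC]_n | (forall i, OK l (z 0 i)) /\ hnorm z = k%:R].
Proof.
pose B := (4 * k)%N.
pose dec (u : 'I_(B.*2.+1)) : algC := (u%:Z - B%:Z)%:~R.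
pose f (g : {ffun 'I_n -> 'I_(B.*2.+1) * 'I_(B.*2.+1)}) : 'rV[algC]_n :=
  \row_i (dec (g i).1 + dec (g i).2 * omegal l).
apply: (@sub_finite_set _ _ (range f)); last exact/finite_image/finite_finset.
move=> z [zO zk] /=.
have H i : exists p : 'I_(B.*2.+1) * 'I_(B.*2.+1),
    z 0 i = dec p.1 + dec p.2 * omegal l.
  have [a [b zE]] := (OK_omega hl sf _).1 (zO i).
  have : z 0 i * (z 0 i)^* <= k%:R.
    rewrite -zk /hnorm (bigD1 i) //= lerDl sumr_ge0 // => j _.
    exact: mul_conjC_ge0.
  rewrite zE normE pmulrn ler_int => h.
  have [ha hb] : (`|a| <= B)%N /\ (`|b| <= B)%N.
    have [fa fb] := form_ge a b.
    by split; apply: sqr_bound; [apply: le_trans fa _|apply: le_trans fb _];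
      rewrite ler_pM2l.
  have hA : (absz (a + B%:Z)%R < B.*2.+1)%N by lia.
  have hB : (absz (b + B%:Z)%R < B.*2.+1)%N by lia.
  exists (Ordinal hA, Ordinal hB); rewrite /dec /=.
  have -> : (absz (a + B%:Z)%R)%:Z - B%:Z = a by lia.
  by have -> : (absz (b + B%:Z)%R)%:Z - B%:Z = b by lia.
have [g gE] := choice H.
exists (finfun g) => //; apply/rowP => i.
by rewrite mxE ffunE gE.
Qed.
End Finite.

(* Main.v *)
Require Import Defs.
From mathcomp Require Import all_boot all_order all_algebra all_field.
From mathcomp Require Import boolp classical_sets functions cardinality fsbigop.
From mathcomp Require Import zify.

Set Implicit Arguments.
Unset Strict Implicit.
Unset Printing Implicit Defensive.

Import Order.TTheory GRing.Theory Num.Theory.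
Local Open Scope classical_set_scope.
Local Open Scope ring_scope.

(** Write an element of [OK l] as [a + b * omegal l] and put
    [m = (l + 1) / 4]; its norm is [a ^ 2 - a * b + b ^ 2 * m].  The level
    enters this form only through the terms with [b <> 0], and [form_ge_level]
    shows that such terms have norm at least [m].  Since the norms of the
    coordinates add up and none is negative, a vector of norm below [m] has
    rational integer coordinates ([short_vector_int]).

    For vectors of rational integers nothing depends on the level any more:
    the reduction of an integer modulo 2 is the same for every [l], so
    membership in [Lambda l C] is a condition on the integers alone
    ([Lambda_int]), and the norm is a sum of squares.  As [l' < l], a vector of
    norm below [(l' + 1) / 4] is short for both levels, so both lattices have
    the same vectors of each such norm, and the two theta series have equal
    coefficients there. *)

(** The vertex of the parabola in [a] gives [b ^ 2 * (m - 1 / 4)], which falls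
    short of [m] when [b = 1] or [b = -1]; in that case integrality of [a]
    gives the bound, because [a ^ 2 - a] and [a ^ 2 + a] are nonnegative. *)
Lemma form_ge_level (a b m : int) : 1 <= m -> b != 0 ->
  m <= a ^+ 2 - a * b + b ^+ 2 * m.
Proof.
move=> m1 b0; have [b1|b2] := leP `|b| 1.
  have [->|->] : b = 1 \/ b = -1 by lia.
    by nia.
  by nia.
have b4 : 4 <= b ^+ 2 by nia.
have := sqr_ge0 (2 * a - b); nia.
Qed.

Section Level.
Variable l : nat.
Hypothesis hl : (l %% 4 = 3)%N.
Hypothesis sf : square_free l.

Lemma short_int (x : algC) (k : nat) : (k < (l + 1) %/ 4)%N ->
  OK l x -> x * x^* <= k%:R -> exists a : int, x = a%:~R.
Proof.
move=> km /(OK_omega hl sf)[a [b ->]]; rewrite normE // pmulrn ler_int => h.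
have [->|b0] := eqVneq b 0; first by exists a; rewrite mul0r addr0.
have m1 : 1 <= ((l + 1) %/ 4)%N%:Z by lia.
have := form_ge_level a m1 b0; lia.
Qed.

Lemma short_vector_int n (z : 'rV[algC]_n) (k : nat) :
  (k < (l + 1) %/ 4)%N -> (forall i, OK l (z 0 i)) -> hnorm z = k%:R ->
  exists a : 'rV[int]_n, z = map_mx intr a.
Proof.
move=> km zO zk.
have /choice[a aE] : forall i, exists a : int, z 0 i = a%:~R.
  move=> i; apply: short_int km (zO i) _.
  rewrite -zk /hnorm (bigD1 i) //= lerDl sumr_ge0 // => j _.
  exact: mul_conjC_ge0.
by exists (\row_i a i); apply/rowP => i; rewrite !mxE.
Qed.

(** The right-hand side does not mention [l]: on vectors of rational integers
    all levels impose the same condition. *)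
Lemma Lambda_int A n (C : {pred 'rV[carrier A]_n}) (a : 'rV[int]_n) :
  Lambda l C (map_mx intr a) <-> map_mx intr a \in C.
Proof.
have intE (c : int) : c%:~R = c%:~R + 0%:~R * omegal l :> algC.
  by rewrite mul0r addr0.
have rhoE : map_mx (@rho l A) (map_mx intr a) = map_mx intr a.
  by apply/rowP => i; rewrite !mxE intE rho_omega // mul0r addr0.
split=> [[_]|aC]; first by rewrite rhoE.
split; last by rewrite rhoE.
by move=> i; rewrite mxE intE; apply: omega_OK.
Qed.

End Level.

Lemma short_Lambda_sub A n (C : {pred 'rV[carrier A]_n}) (l l' k : nat)
    (z : 'rV[algC]_n) :
  admissible A l -> admissible A l' -> (k < (l + 1) %/ 4)%N ->
  hnorm z = k%:R -> Lambda l C z -> Lambda l' C z.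
Proof.
move=> al al' km zk zL.
have [_ sf _] := al; have [_ sf' _] := al'.
have hl := admissible_mod4 al; have hl' := admissible_mod4 al'.
have [a aE] := short_vector_int hl sf km zL.1 zk.
by move: zL; rewrite aE => /(Lambda_int hl sf) /(Lambda_int hl' sf').
Qed.

Lemma Theta_low_coef A n (C : {pred 'rV[carrier A]_n}) (l l' k : nat) :
  admissible A l -> admissible A l' ->
  (k < (l + 1) %/ 4)%N -> (k < (l' + 1) %/ 4)%N ->
  Theta (Lambda l C) k = Theta (Lambda l' C) k.
Proof.
move=> al al' km km'.
rewrite /Theta fsbig_mkcond [RHS]fsbig_mkcond; apply: eq_fsbigr => z _.
rewrite /patch; case: (eqVneq (hnorm z) k%:R) => [zk|_]; last by rewrite !if_same.
have -> // : (z \in Lambda l C) = (z \in Lambda l' C).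
by apply/idP/idP => /set_mem zL; apply/mem_set; apply: short_Lambda_sub zk zL.
Qed.

Theorem theorem1 (A : alphabet) (n : nat) (C : {pred 'rV[carrier A]_n})
    (hC : linear_code C) (l l' : nat)
    (hl : admissible A l) (hl' : admissible A l') (hll' : (l' < l)%N) :
  exists2 E : qseries, bigOq ((l' + 1) %/ 4)%N E &
    Theta (Lambda l C) = Theta (Lambda l' C) \+ E.
Proof.
exists (fun k => Theta (Lambda l C) k - Theta (Lambda l' C) k); last first.
  by apply/funext => k /=; rewrite addrC subrK.
move=> k /= km'; apply/eqP; rewrite subr_eq0; apply/eqP.
apply: Theta_low_coef => //; apply: leq_trans km' _.
by rewrite leq_div2r // leq_add2r ltnW.
Qed.
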